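(* Let $x,y,z_1,z_2$ be indeterminates. For every integer $n\ge 2$, the two types of adjacent-boundary doubly-refined ASM generating function are related by $$\begin{aligned} &\bigl((z_1-1)(z_2-1)-yz_1z_2\bigr)\,Z^{\mathrm{adj}}_n(x,y;z_1,z_2)-\bigl(x(z_1-1)(z_2-1)-y\bigr)\,z_1z_2\,\widetilde{Z}^{\mathrm{adj}}_n(x,y;z_1,z_2)\\ &\qquad=(z_1-1)(z_2-1)\bigl(1-(xz_1z_2)^n\bigr)\,Z_{n-1}(x,y). \end{aligned}$$
   Context: An alternating sign matrix (ASM) is a square matrix with entries in $\{0,1,-1\}$ such that along each row and each column the nonzero entries alternate in sign and sum to $1$. $\mathrm{ASM}(n)$ is the set of $n\times n$ ASMs. The first and last rows and columns of an ASM each contain exactly one $1$, all other entries there being $0$. For $A\in\mathrm{ASM}(n)$ define: $\nu(A)=\sum_{1\le i<i'\le n,\;1\le j'\le j\le n}A_{ij}A_{i'j'}$ (a nonnegative integer); $\mu(A)=$ number of $-1$'s in $A$; $\rho_{\mathrm T}(A)=$ number of $0$'s to the left of the $1$ in the top row; $\rho_{\mathrm R}(A)=$ number of $0$'s below the $1$ in the right-most column; $\rho_{\mathrm L}(A)=$ number of $0$'s above the $1$ in the left-most column. Generating functions (for $n\ge1$): $Z^{\mathrm{adj}}_n(x,y;z_1,z_2)=\sum_{A\in\mathrm{ASM}(n)}x^{\nu(A)}y^{\mu(A)}z_1^{\rho_{\mathrm T}(A)}z_2^{\rho_{\mathrm L}(A)}$; $\widetilde{Z}^{\mathrm{adj}}_n(x,y;z_1,z_2)=\sum_{A\in\mathrm{ASM}(n)}x^{\nu(A)}y^{\mu(A)}z_1^{\rho_{\mathrm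 T}(A)}z_2^{\rho_{\mathrm R}(A)}$; $Z_n(x,y)=\sum_{A\in\mathrm{ASM}(n)}x^{\nu(A)}y^{\mu(A)}$. *)

(* Defs.v *)
From HB Require Import structures.
From mathcomp Require Import all_boot all_order all_algebra.

Set Implicit Arguments.
Unset Strict Implicit.
Unset Printing Implicit Defensive.

Import Order.TTheory GRing.Theory Num.Theory.
Local Open Scope ring_scope.

Definition alternates (s : seq int) : bool :=
  sorted (fun a b => a * b < 0) [seq a <- s | a != 0]
  && (\sum_(a <- s) a == 1).

Definition is_asm (n : nat) (A : 'M[int]_n) : bool :=
  [&& [forall i, forall j, A i j \in [:: 0; 1; -1]],
      [forall i, alternates [seq A i j | j <- enum 'I_n]]
    & [forall j, alternates [seq A i j | i <- enum 'I_n]]].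

(* Matrices over int do not form a finType, so ASM(n) is enumerated through
   matrices over the three-element subtype {0, 1, -1} of int. *)
Definition entry : finType := seq_sub [:: 0; 1; -1 : int].

Definition int_mx (n : nat) (A : 'M[entry]_n) : 'M[int]_n := map_mx val A.

(* int_mx_inj and ASM_int_mx below: int_mx is a bijection from ASM n to the
   integer matrices satisfying is_asm. *)
Definition ASM (n : nat) : {set 'M[entry]_n} := [set A | is_asm (int_mx A)].

Section Statistics.
Variables (n : nat) (A : 'M[int]_n).

Definition nu : int :=
  \sum_(i < n) \sum_(i' < n | (i < i')%N)
    \sum_(j < n) \sum_(j' < n | (j' <= j)%N) A i j * A i' j'.

Definition mu : nat := #|[set p : 'I_n * 'I_n | A p.1 p.2 == -1]|.

(* Each boundary line of an ASM has exactly one 1; the index k bound below is its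
   position.  The extremal row or column is bound existentially so that the
   definitions make sense for every n. *)
Definition rhoT : nat :=
  #|[set j : 'I_n | [exists i : 'I_n, exists k : 'I_n,
      [&& i == 0%N :> nat, A i k == 1, (j < k)%N & A i j == 0]]]|.

Definition rhoR : nat :=
  #|[set i : 'I_n | [exists j : 'I_n, exists k : 'I_n,
      [&& j.+1 == n, A k j == 1, (k < i)%N & A i j == 0]]]|.

Definition rhoL : nat :=
  #|[set i : 'I_n | [exists j : 'I_n, exists k : 'I_n,
      [&& j == 0%N :> nat, A k j == 1, (i < k)%N & A i j == 0]]]|.

End Statistics.

(* The exponent `|nu _|%N is nu itself, by nu_ge0 below. *)
Section GeneratingFunctions.
Variables (R : comNzRingType) (n : nat).

Definition Zadj (x y z1 z2 : R) : R :=
  \sum_(A in ASM n) x ^+ `|nu (int_mx A)|%N * y ^+ mu (int_mx A)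
                    * z1 ^+ rhoT (int_mx A) * z2 ^+ rhoL (int_mx A).

Definition Zadjt (x y z1 z2 : R) : R :=
  \sum_(A in ASM n) x ^+ `|nu (int_mx A)|%N * y ^+ mu (int_mx A)
                    * z1 ^+ rhoT (int_mx A) * z2 ^+ rhoR (int_mx A).

Definition Z (x y : R) : R :=
  \sum_(A in ASM n) x ^+ `|nu (int_mx A)|%N * y ^+ mu (int_mx A).

End GeneratingFunctions.

Lemma int_mx_inj (n : nat) : injective (@int_mx n).
Proof.
move=> A B /matrixP eAB; apply/matrixP => i j.
by apply: val_inj; have := eAB i j; rewrite !mxE.
Qed.

Lemma ASM_int_mx (n : nat) (A : 'M[int]_n) :
  is_asm A -> exists2 B, B \in ASM n & int_mx B = A.
Proof.
move=> asmA; have /and3P[/forallP inA _ _] := asmA.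
have inA' i j : A i j \in [:: 0; 1; -1] by have /forallP := inA i.
have eA : int_mx (\matrix_(i, j) (SeqSub (inA' i j) : entry)) = A.
  by apply/matrixP => i j; rewrite !mxE.
by exists (\matrix_(i, j) (SeqSub (inA' i j) : entry)); rewrite ?inE ?eA.
Qed.

Lemma alternates_partial (s : seq int) (k : nat) :
  all (fun a => a \in [:: 0; 1; -1]) s -> alternates s ->
  0 <= \sum_(a <- take k s) a.
Proof.
move=> s01 /andP[alt /eqP sum1].
pose alt2 e (t : seq int) := path (fun a b => a * b < 0) e [seq a <- t | a != 0].
have key (t : seq int) : all (fun a => a \in [:: 0; 1; -1]) t ->
  (alt2 1 t -> forall m, -1 <= \sum_(a <- take m t) a <= 0) /\
  (alt2 (-1) t -> forall m, 0 <= \sum_(a <- take m t) a <= 1).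
  elim: t => [|a t IH] /=; first by move=> _; split=> _ m; rewrite big_nil.
  case/andP => a01 /IH[IH1 IH2].
  move: a01; rewrite !inE => /or3P[] /eqP->; rewrite /alt2 /=; split=> //.
  - by move=> /IH1 h [|m] /=; rewrite ?big_nil // big_cons add0r.
  - by move=> /IH2 h [|m] /=; rewrite ?big_nil // big_cons add0r.
  - move=> /IH1 h [|m] /=; rewrite ?big_nil // big_cons.
    by have /andP[h1 h2] := h m; rewrite -lerBlDl h1 -lerBrDl h2.
  - move=> /IH2 h [|m] /=; rewrite ?big_nil // big_cons.
    by have /andP[h1 h2] := h m; rewrite -lerBlDl h1 -lerBrDl h2.
move: alt; case E: [seq a <- s | a != 0] => [|b u] alt.
  have : \sum_(a <- s) a = 0.
    apply: big1_seq => a /= as_; apply/eqP; apply: contraT => a0.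
    by rewrite -(in_nil a) -E mem_filter a0.
  by rewrite sum1.
have : b \in [seq a <- s | a != 0] by rewrite E mem_head.
rewrite mem_filter => /andP[b0 /(allP s01)]; rewrite !inE (negPf b0) /=.
case/orP => /eqP eb; subst b.
  have /(key _ s01).2 h : alt2 (-1) s by rewrite /alt2 E.
  by have /andP[] := h k.
have /(key _ s01).1 h : alt2 1 s by rewrite /alt2 E.
by have := h (size s); rewrite take_size sum1.
Qed.

Lemma nu_ge0 (n : nat) (A : 'M[int]_n) : is_asm A -> 0 <= nu A.
Proof.
case/and3P=> /forallP A01 /forallP rowA /forallP colA.
have partial (f : 'I_n -> int) k : (forall i, f i \in [:: 0; 1; -1]) ->
    alternates [seq f i | i <- enum 'I_n] -> 0 <= \sum_(i < n | (i < k)%N) f i.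
  move=> f01 /alternates_partial /= /(_ k).
  have -> : all (fun a => a \in [:: 0; 1; -1]) [seq f i | i <- enum 'I_n].
    by apply/allP => _ /mapP[i _ ->].
  move/(_ isT); rewrite -map_take big_map; congr (_ <= _).
  rewrite [RHS]big_mkcond /= -[RHS]big_enum /=.
  rewrite -[in RHS](cat_take_drop k (enum 'I_n)) big_cat /=.
  have eU := cat_take_drop k (enum 'I_n).
  have inT (i : 'I_n) : (i \in take k (enum 'I_n)) = (i < k)%N.
    by rewrite in_take ?mem_enum // index_enum_ord.
  rewrite [X in _ = _ + X]big1_seq ?addr0 => [|i /= iD].
    by rewrite big_seq [RHS]big_seq; apply: eq_bigr => i; rewrite inT => ->.
  case: ifP => // ik; have := enum_uniq 'I_n.
  by rewrite -eU cat_uniq => /and3P[_ /hasPn/(_ i iD)/negP[]]; rewrite inT.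
have -> : nu A = \sum_(i' < n) \sum_(j < n)
    (\sum_(i < n | (i < i')%N) A i j) * (\sum_(j' < n | (j' < j.+1)%N) A i' j').
  rewrite /nu (exchange_big_dep predT) //=; apply: eq_bigr => i' _.
  rewrite exchange_big /=; apply: eq_bigr => j _.
  by rewrite mulr_suml; apply: eq_bigr => i _; rewrite mulr_sumr.
apply: sumr_ge0 => i' _; apply: sumr_ge0 => j _; apply: mulr_ge0; apply: partial => //.
- by move=> i; have /forallP := A01 i.
- by have /forallP := A01 i'.
Qed.

(* Main.v *)
(** An alternating sign matrix is a six-vertex configuration: the edges carry
    the partial row and column sums, which are 0 or 1.  Give the first column
    and the first row their own spectral parameters, encoded by [z2] and [z1].
    By the Yang-Baxter equation the transfer operator of the special column
    commutes with the ordinary ones, so that column can be moved from the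
    left-most to the right-most position.  Both positions yield the generating
    function with an altered weight at the corner shared by the special row and
    column; each is linear in that corner weight, and the configurations whose
    corner entry is 1 contribute a multiple of [Z_(n-1)]. *)

Require Import Defs.
From mathcomp Require Import all_boot all_order all_algebra.
From mathcomp Require Import mpoly ring zify.
Import GRing.Theory.
Local Open Scope ring_scope.
Set Implicit Arguments.
Unset Strict Implicit.
Unset Printing Implicit Defensive.

(** * Six-vertex transfer operators *)

Lemma big_tupleS (R : nmodType) (T : finType) m (F : seq T -> R) :
  \sum_(k : m.+1.-tuple T) F k = \sum_(b : T) \sum_(k : m.-tuple T) F (b :: k).
Proof.
rewrite pair_big /=.
rewrite (reindex (fun p : T * m.-tuple T => [tuple of p.1 :: p.2])) //=.
exists (fun k => (thead k, [tuple of behead k])) => [[b k] _|k _] /=.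
  by congr pair; apply: val_inj.
by rewrite -tuple_eta.
Qed.

Lemma big_tuple0 (R : nmodType) (T : finType) (F : seq T -> R) : \sum_(k : 0.-tuple T) F k = F [::].
Proof.
rewrite (bigD1 [tuple]) //= big1 ?addr0 // => k.
by rewrite tuple0.
Qed.

Section Transfer.
Variable R : idomainType.

Definition weight := bool -> bool -> bool -> R.

(* [a] and [b] are the horizontal edges left and right of the vertex (the
   partial row sums before and after the entry), [v] and [v'] the vertical edges
   above and below it.  The entry is [b - a = v' - v]; a weight need not depend
   on [v'], which this conservation law determines. *)
Definition vertex (w : weight) (a b v v' : bool) : R :=
  if (a + v' == b + v)%N then w a b v else 0.

(* Transfer operator of one column whose vertices have weights [ws] from top to
   bottom: the top edge is [v], and the bottom edge is required to be [true]. *)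
Fixpoint transfer (ws : seq weight) (v : bool) (h h' : seq bool) : R :=
  match ws, h, h' with
  | w :: ws', a :: h1, b :: h1' =>
      \sum_(v' : bool) vertex w a b v v' * transfer ws' v' h1 h1'
  | [::], [::], [::] => v%:R
  | _, _, _ => 0
  end.

(** Partition function with left boundary [h]: the edges above the columns are [false], and those on
    the right boundary must be [true], the row sums being 1. *)
Fixpoint paths (m : nat) (cs : seq (seq weight)) (h : seq bool) : R :=
  if cs is c :: cs' then \sum_(k : m.-tuple bool) transfer c false h k * paths m cs' k
  else (all id h)%:R.

Definition transfer2 m ws ws' (v : bool * bool) h h' : R :=
  \sum_(k : m.-tuple bool) transfer ws v.1 h k * transfer ws' v.2 k h'.

Definition vertex2 (s w : weight) (a b : bool) (v v' : bool * bool) : R :=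
  \sum_(k : bool) vertex s a k v.1 v'.1 * vertex w k b v.2 v'.2.

Lemma transfer2_cons m s w ss ws v a b h h' :
  transfer2 m.+1 (s :: ss) (w :: ws) v (a :: h) (b :: h') =
  \sum_(v' : bool * bool) vertex2 s w a b v v' * transfer2 m ss ws v' h h'.
Proof.
rewrite /transfer2 (@big_tupleS _ _ m (fun k => transfer _ _ _ k * transfer _ _ k _)) /=.
rewrite /vertex2; under [RHS]eq_bigr do rewrite mulr_suml.
rewrite [RHS]exchange_big /=; apply: eq_bigr => k _.
under [RHS]eq_bigr do rewrite mulr_sumr.
rewrite [RHS]exchange_big /=; apply: eq_bigr => l _.
rewrite mulr_suml -(pair_big predT predT (fun i j : bool =>
  vertex s a k v.1 i * vertex w k b v.2 j * (transfer ss i h l * transfer ws j l h'))) /=.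
apply: eq_bigr => i _; rewrite mulr_sumr; apply: eq_bigr => j _.
by rewrite mulrACA.
Qed.

Lemma transfer2_nil v : transfer2 0 [::] [::] v [::] [::] = (v == (true, true))%:R.
Proof.
rewrite /transfer2 (big_tuple0 (fun k => transfer _ _ _ k * transfer _ _ k _)) /=.
by case: v => [[] []]; rewrite ?(mul1r, mul0r).
Qed.

(* Yang-Baxter: [X] intertwines the pair of columns [s], [w] with [w], [s].  The
   vertical edges above the top row are both [false], so the top vertices [s1],
   [w1] only have to satisfy the weaker condition [XKt]. *)
Section Intertwine.
Variables (s w : weight) (X : bool * bool -> bool * bool -> R) (rho : R).
Hypothesis XK : forall a b v v',
  \sum_u X v u * vertex2 s w a b u v' = \sum_u vertex2 w s a b v u * X u v'.
Hypothesis X11 : forall v, X v (true, true) = (v == (true, true))%:R * rho.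

(** Train argument: [XK] pushes [X] down row by row until it meets the bottom edges, both [true],
    where [X11] makes it the scalar [rho]. *)
Lemma transfer2_bulk m v h h' : size h = m -> size h' = m ->
  rho * transfer2 m (nseq m w) (nseq m s) v h h' =
  \sum_u X v u * transfer2 m (nseq m s) (nseq m w) u h h'.
Proof.
elim: m v h h' => [|m IH] v [|a h] [|b h'] //= => [_ _|[hs] [hs']].
  rewrite transfer2_nil (bigD1 (true, true)) //= transfer2_nil eqxx mulr1 X11 mulrC.
  by rewrite big1 ?addr0 // => u /negPf u11; rewrite transfer2_nil u11 mulr0.
rewrite transfer2_cons mulr_sumr.
under [LHS]eq_bigr => u _ do rewrite mulrCA IH //.
under [RHS]eq_bigr => u _ do rewrite transfer2_cons mulr_sumr.
rewrite [RHS]exchange_big /=.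
under [RHS]eq_bigr => v' _.
  under eq_bigr => u _ do rewrite mulrA.
  rewrite -mulr_suml XK mulr_suml.
over.
rewrite [RHS]exchange_big /=; apply: eq_bigr => u _.
by rewrite mulr_sumr; apply: eq_bigr => u' _; rewrite mulrA.
Qed.

Variables (s1 w1 : weight).
Hypothesis rho0 : rho != 0.
Hypothesis XKt : forall a b u,
  \sum_v vertex2 w1 s1 a b (false, false) v * X v u =
  rho * vertex2 s1 w1 a b (false, false) u.

(** In the top row [XKt] absorbs the [X] left by [transfer2_bulk] and releases the same factor
    [rho], which cancels. *)
Lemma transfer2_comm m h h' : size h = m.+1 -> size h' = m.+1 ->
  transfer2 m.+1 (w1 :: nseq m w) (s1 :: nseq m s) (false, false) h h' =
  transfer2 m.+1 (s1 :: nseq m s) (w1 :: nseq m w) (false, false) h h'.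
Proof.
case: h h' => [|a h] [|b h'] //= [hs] [hs']; apply: (mulfI rho0).
rewrite !transfer2_cons !mulr_sumr.
under [LHS]eq_bigr => u _ do rewrite mulrCA transfer2_bulk // mulr_sumr.
rewrite exchange_big /=; apply: eq_bigr => u _.
under eq_bigr => v _ do rewrite mulrA.
by rewrite -mulr_suml XKt mulrA.
Qed.

Lemma paths_comm m k h : size h = m.+1 ->
  paths m.+1 ((s1 :: nseq m s) :: nseq k (w1 :: nseq m w)) h =
  paths m.+1 (rcons (nseq k (w1 :: nseq m w)) (s1 :: nseq m s)) h.
Proof.
elim: k h => [//|k IH] h hs.
rewrite [RHS]/=; under [RHS]eq_bigr => l _ do rewrite -IH ?size_tuple //.
rewrite /=.
under eq_bigr => l _ do rewrite mulr_sumr.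
rewrite exchange_big /=; under [RHS]eq_bigr => l _ do rewrite mulr_sumr.
rewrite [RHS]exchange_big /=; apply: eq_bigr => l _.
under eq_bigr => i _ do rewrite mulrA.
under [RHS]eq_bigr => i _ do rewrite mulrA.
rewrite -!mulr_suml; congr (_ * _).
by have := transfer2_comm hs (size_tuple l); rewrite /transfer2 /= => ->.
Qed.

End Intertwine.

(** * Weights of the refined model and their R-matrix *)

Variables (x y z1 z2 : R).

(* [nu] counts the entries with a 1 on the edges above and to the right; at a
   vertex allowed by [vertex] such an entry is a 0. *)
Definition bulk : weight := fun a b v => x ^+ (b && v) * y ^+ (a && ~~ b).

(* The value that makes [special] satisfy the Yang-Baxter equation with [bulk]:
   both have the same invariant [(a1 a2 + b1 b2 - c1 c2) / sqrt (a1 a2 b1 b2)]. *)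
Definition special_minus : R := (z2 - 1) * (x * z2 - 1) + y * z2.

(* In the left-most column, where [a = false], [z2] marks the zeros above the 1;
   in the right-most column, where [b = true], it marks those below the 1. *)
Definition special : weight := fun a b v =>
  x ^+ [&& a, b & v] * z2 ^+ ((a == b) && (a == v)) * special_minus ^+ (a && ~~ b).

Definition top : weight := fun a b v => z1 ^+ (~~ b) * bulk a b v.

(* [p] and [q] weigh a 0 whose horizontal edges are [false] and [true], and [r]
   weighs a 1; the edge above the corner is always [false]. *)
Definition corner (p q r : R) : weight := fun a b _ =>
  if b then if a then q else r else p.

(** The six-vertex R-matrix between a special and an ordinary column; it conserves the number of
    [true] edges. Its entry at two [true] edges plays the role of [rho]. *)
Definition Rmx (v u : bool * bool) : R :=
  match v, u with
  | (false, false), (false, false) | (true, true), (true, true) => x * (z2 - 1) + y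
  | (false, true), (false, true) => special_minus
  | (false, true), (true, false) => x * (z2 - 1)
  | (true, false), (false, true) => z2 - 1
  | (true, false), (true, false) => y
  | _, _ => 0
  end.

Lemma big_bool2 (F : bool * bool -> R) :
  \sum_u F u = F (true, true) + F (true, false) + (F (false, true) + F (false, false)).
Proof.
rewrite -(eq_bigr _ (fun u _ => congr1 F (esym (surjective_pairing u)))).
by rewrite -(pair_big predT predT (fun a b => F (a, b))) /= !big_bool.
Qed.

Lemma Rmx_bulk a b v v' :
  \sum_u Rmx v u * vertex2 special bulk a b u v' =
  \sum_u vertex2 bulk special a b v u * Rmx u v'.
Proof.
rewrite !big_bool2 /vertex2 !big_bool.
case: a; case: b; case: v => [[] []]; case: v' => [[] []];
  rewrite /vertex /bulk /special /Rmx /special_minus /=; ring.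
Qed.

(** The corner weights are chosen to make this hold. Those of a corner 0 become the coefficients in
    the final relation, the second one up to the factor [z1 * z2]. *)
Lemma Rmx_top a b u :
  \sum_v vertex2 top (corner ((z1 - 1) * (z2 - 1) - y * z1 * z2)
              (x * (z1 - 1) * (z2 - 1) - y) (- y)) a b (false, false) v * Rmx v u =
  (x * (z2 - 1) + y) * vertex2 (corner ((z1 - 1) * (z2 - 1) - y * z1 * z2)
              (x * (z1 - 1) * (z2 - 1) - y) (- y)) top a b (false, false) u.
Proof.
rewrite !big_bool2 /vertex2 !big_bool.
case: a; case: b; case: u => [[] []];
  rewrite /vertex /bulk /special /Rmx /special_minus /top /corner /bulk /=; ring.
Qed.

(** * Linearity in the corner weight, and configurations with corner entry 1 *)

Lemma paths_cons m (c : seq weight) cs h :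
  paths m (c :: cs) h = \sum_(k : m.-tuple bool) transfer c false h k * paths m cs k.
Proof. by []. Qed.

Lemma paths_consS m (c : seq weight) cs h :
  paths m.+1 (c :: cs) h = \sum_(b : bool) \sum_(k : m.-tuple bool)
    transfer c false h (b :: k) * paths m.+1 cs (b :: k).
Proof. exact: (@big_tupleS _ _ m (fun k => transfer c false h k * paths m.+1 cs k)). Qed.

Lemma paths1 m (c : seq weight) h : paths m [:: c] h = transfer c false h (nseq m true).
Proof.
rewrite /= (bigD1 [tuple of nseq m true]) //= all_nseq orbT mulr1 big1 ?addr0 // => k.
move=> kN; case: (boolP (all id k)) => [kT|_]; last by rewrite mulr0.
case/eqP: kN; apply: val_inj => /=; rewrite -[in RHS](size_tuple k).
by apply/all_pred1P; apply: sub_all kT => -[].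
Qed.

Lemma transfer_corner p q r (ws : seq weight) h h' :
  transfer (corner p q r :: ws) false h h' =
  p * transfer (corner 1 0 0 :: ws) false h h' + q * transfer (corner 0 1 0 :: ws) false h h'
  + r * transfer (corner 0 0 1 :: ws) false h h'.
Proof.
case: h h' => [|a h] [|b h'] //=; rewrite ?mulr0 ?addr0 //.
by rewrite !big_bool; case: a; case: b; rewrite /vertex /corner /=; ring.
Qed.

(** No term in [q]: the edge left of a left-most corner is [false]. *)
Lemma paths_corner_left p q r m (ws : seq weight) cs h :
  paths m.+1 ((corner p q r :: ws) :: cs) (false :: h) =
  p * paths m.+1 ((corner 1 0 0 :: ws) :: cs) (false :: h) +
  r * paths m.+1 ((corner 0 0 1 :: ws) :: cs) (false :: h).
Proof.
rewrite !paths_cons !mulr_sumr -big_split; apply: eq_bigr => k _.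
rewrite (transfer_corner p q r) /=.
case: (tval k) => [|b h'] /=; first by rewrite !mulr0 !mul0r !mulr0 !addr0 mul0r.
by rewrite !big_bool; case: b; rewrite /vertex /corner /=; ring.
Qed.

(** No term in [p]: the edge right of a right-most corner is [true]. *)
Lemma paths_corner_right p q r m k c (ws : seq weight) h : size h = m.+1 ->
  paths m.+1 (rcons (nseq k c) (corner p q r :: ws)) h =
  q * paths m.+1 (rcons (nseq k c) (corner 0 1 0 :: ws)) h +
  r * paths m.+1 (rcons (nseq k c) (corner 0 0 1 :: ws)) h.
Proof.
elim: k h => [|k IH] h hs.
  rewrite /nseq /ncons /iter /rcons !paths1 transfer_corner.
  case: h hs => [|a h] //= _.
  by rewrite !big_bool; case: a; rewrite /vertex /corner /=; ring.
rewrite !mulr_sumr -big_split /=; apply: eq_bigr => l _.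
by rewrite IH ?size_tuple // mulrDr; congr (_ + _); rewrite mulrCA.
Qed.

Lemma transfer_special_false m h' : size h' = m ->
  transfer (nseq m special) true (nseq m false) h' = (h' == nseq m false)%:R.
Proof.
elim: m h' => [|m IH] [|b h'] //= [hs]; rewrite big_bool /=.
case: b; rewrite /vertex /= ?mul0r ?addr0 ?eqseq_cons //=.
by rewrite IH // /special /= !mul1r.
Qed.

Lemma transfer_special_true m h : size h = m ->
  transfer (nseq m special) true h (nseq m true) = (all id h)%:R * (x * z2) ^+ m.
Proof.
elim: m h => [|m IH] [|a h] //= => [_|[hs]]; first by rewrite mulr1.
rewrite big_bool /=; case: a; rewrite /vertex /= ?mul0r ?addr0 //.
rewrite IH // /special /= [in RHS]exprS; ring.
Qed.

Lemma paths_left_one m cs :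
  paths m.+1 ((corner 0 0 1 :: nseq m special) :: cs) (nseq m.+1 false) =
  paths m.+1 cs (true :: nseq m false).
Proof.
rewrite paths_consS big_bool /=.
rewrite [X in _ + X]big1 ?addr0 => [|k _]; last first.
  by rewrite big_bool /vertex /= !mul0r add0r mul0r.
rewrite (bigD1 [tuple of nseq m false]) //= [X in _ + X]big1 ?addr0 => [|k kN].
  by rewrite big_bool /vertex /= mul0r addr0 transfer_special_false ?size_nseq // eqxx !mul1r.
rewrite big_bool /vertex /= mul0r addr0 transfer_special_false ?size_tuple //.
by rewrite -val_eqE /= in kN; rewrite (negPf kN) mulr0 mul0r.
Qed.

(** The edges above being [false], a top edge that is [true] stays [true]; the top row then consists
    of 0s of weight 1 and can be deleted. *)
Lemma paths_top_true m k h :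
  paths m.+1 (nseq k (top :: nseq m bulk)) (true :: h) =
  paths m (nseq k (nseq m bulk)) h.
Proof.
elim: k h => [//|k IH] h.
rewrite ?rcons_cons paths_consS big_bool /=.
rewrite [X in _ + X]big1 ?addr0 => [|l _]; last first.
  by rewrite big_bool /vertex /= !mul0r add0r mul0r.
apply: eq_bigr => l _.
by rewrite IH big_bool /vertex /= /top /bulk /= !mul0r !mul1r add0r.
Qed.

(** A corner 1 needs a [false] edge on its left, but a [true] top edge persists up to the corner. *)
Lemma paths_right_true m k h :
  paths m.+1 (rcons (nseq k (top :: nseq m bulk)) (corner 0 0 1 :: nseq m special))
    (true :: h) = 0.
Proof.
elim: k h => [|k IH] h.
  rewrite /nseq /ncons /iter /rcons !paths1 /= big_bool /vertex /=.
  by rewrite !mul0r addr0.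
rewrite ?rcons_cons paths_consS big_bool /=.
rewrite !big1 ?addr0 // => l _; last by rewrite IH mulr0.
by rewrite big_bool /vertex /= !mul0r add0r mul0r.
Qed.

(** The corner 1 freezes the top row, whose [k] 0s weigh [z1] each, and the special column, whose
    [m] 0s weigh [x * z2] each; the ordinary part remains. *)
Lemma paths_right_one m k h : size h = m ->
  paths m.+1 (rcons (nseq k (top :: nseq m bulk)) (corner 0 0 1 :: nseq m special))
    (false :: h) = z1 ^+ k * (x * z2) ^+ m * paths m (nseq k (nseq m bulk)) h.
Proof.
elim: k h => [|k IH] h hs.
  rewrite /nseq /ncons /iter /rcons !paths1 /= big_bool /vertex /=.
  by rewrite mul0r mul1r addr0 mul1r transfer_special_true // mulrC.
rewrite ?rcons_cons paths_consS big_bool /=.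
rewrite big1 ?add0r => [|l _]; last by rewrite paths_right_true mulr0.
rewrite mulr_sumr; apply: eq_bigr => l _.
rewrite IH ?size_tuple // big_bool /vertex /= /top /bulk /= mul0r add0r [z1 ^+ k.+1]exprS.
by ring.
Qed.

Lemma paths_relation m : x * (z2 - 1) + y != 0 ->
  ((z1 - 1) * (z2 - 1) - y * z1 * z2) *
    paths m.+1 ((corner (z1 * z2) 1 1 :: nseq m special) :: nseq m (top :: nseq m bulk))
      (nseq m.+1 false)
  - (x * (z1 - 1) * (z2 - 1) - y) * z1 * z2 *
    paths m.+1 (rcons (nseq m (top :: nseq m bulk)) (corner 1 1 1 :: nseq m special))
      (nseq m.+1 false)
  = (z1 - 1) * (z2 - 1) * (1 - (x * z1 * z2) ^+ m.+1) *
    paths m (nseq m (nseq m bulk)) (nseq m false).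
Proof.
move=> rho0.
have X11 v : Rmx v (true, true) = (v == (true, true))%:R * (x * (z2 - 1) + y).
  by case: v => [[] []]; rewrite ?mul0r ?mul1r.
have := paths_comm Rmx_bulk X11 rho0 Rmx_top m (size_nseq m.+1 false).
rewrite (paths_corner_right _ _ _ _ _ _ (size_nseq m.+1 false)).
rewrite (paths_corner_right 1 _ _ _ _ _ (size_nseq m.+1 false)).
rewrite [nseq m.+1 false]/= !(paths_corner_left _ 1) (paths_corner_left _ (_ - y)).
rewrite (paths_left_one m) paths_top_true paths_right_one ?size_nseq //.
(* [a] and [c] carry the configurations with a corner 0 on the left and on the right; [b] is the
   common ordinary part. *)
set a := paths _ _ _; set b := paths _ _ _; set c := paths _ _ _ => E.
rewrite exprS !exprMn.
(* Both sides of [E] are split off with the factor [z1 * z2]. Adding back the [- y] terms turns the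
   coefficients of the corner-1 parts into multiples of [(z1 - 1) * (z2 - 1)]. *)
transitivity (z1 * z2 * (((z1 - 1) * (z2 - 1) - y * z1 * z2) * a + - y * b)
   - z1 * z2 * ((x * (z1 - 1) * (z2 - 1) - y) * c + - y * (z1 ^+ m * (x ^+ m * z2 ^+ m) * b))
   + (z1 - 1) * (z2 - 1) * (1 - (x * z1 * z2 * (x ^+ m * z1 ^+ m * z2 ^+ m))) * b).
  by ring.
by rewrite E exprMn; ring.
Qed.

End Transfer.

(** * Alternating sign matrices as six-vertex configurations *)

(* [v] is the sum of the entries read so far. *)
Fixpoint walk (v : bool) (s : seq int) : bool :=
  if s is e :: s' then
    if e == 0 then walk v s' else
    if e == 1 then ~~ v && walk true s' else
    (e == -1) && (v && walk false s')
  else v.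

(** The edge value records the sign of the last nonzero entry: [true] after 1, [false] after -1.
    Starting at [false] thus asks the first nonzero entry to be 1. *)
Lemma path_walk v s : all (fun a => a \in [:: 0; 1; -1 : int]) s ->
  path (fun a b : int => a * b < 0) (if v then 1 else -1) [seq a <- s | a != 0] ->
  (0 <= v%:Z + \sum_(a <- s) a <= 1) /\ walk v s = (v%:Z + \sum_(a <- s) a == 1).
Proof.
elim: s v => [|e s IH] v /=; first by rewrite big_nil; case: v.
case/andP => + s01; rewrite big_cons !inE => /or3P[] /eqP-> /=.
- by rewrite add0r; apply: IH.
- by case: v => //= /(IH true s01)[]; rewrite add0r.
- case: v => //= /(IH false s01)[]; rewrite !add0r => h1 h2.
  by rewrite addrA subrr add0r.
Qed.

Lemma path_of_walk v s : walk v s ->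
  path (fun a b : int => a * b < 0) (if v then 1 else -1) [seq a <- s | a != 0].
Proof.
elim: s v => [|e s IH] v //=; case: eqP => [_|_] /=; first exact: IH.
case: eqP => [->|_]; first by case: v => //= /(IH true).
by case: eqP => [->|_] //; case: v => //= /(IH false).
Qed.

Lemma alternates_walk s : all (fun a => a \in [:: 0; 1; -1 : int]) s ->
  alternates s = walk false s.
Proof.
move=> s01; rewrite /alternates; apply/andP/idP => [[]|ws]; last first.
  have alt := path_of_walk ws; have [_] := @path_walk false s s01 alt.
  by rewrite ws add0r (path_sorted alt).
elim: s s01 => [|e s IH] /=; first by rewrite big_nil.
case/andP => + s01; rewrite big_cons !inE.
case/or3P => /eqP-> //=; first by rewrite add0r; apply: IH.
- by move=> /(@path_walk true s s01)[_ ->].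
(* A leading -1 is impossible: the rest sums to at most 1, so the total is at most 0. *)
- by move=> /(@path_walk false s s01)[] + _; rewrite add0r; move: (\sum_(a <- s) a) => S; lia.
Qed.

Lemma mkseq_cons T (g : nat -> T) n : mkseq g n.+1 = g 0%N :: mkseq (g \o S) n.
Proof. by rewrite /mkseq /= (iotaDl 1 0 n) -map_comp. Qed.

(** The equation says that the partial sum is 0 or 1 and names the edge value encoding it. *)
Lemma walk_partial v (g : nat -> int) n i : walk v (mkseq g n) -> (i <= n)%N ->
  v%:Z + \sum_(0 <= k < i) g k = (v%:Z + \sum_(0 <= k < i) g k == 1)%:Z.
Proof.
elim: i v g n => [|i IH] v g n; first by rewrite big_geq // addr0; case: v.
case: n => [//|n]; rewrite mkseq_cons ltnS big_nat_recl //=.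
have E (v' : bool) : v%:Z + g 0%N = v'%:Z -> walk v' (mkseq (g \o S) n) -> (i <= n)%N ->
  v%:Z + (g 0%N + \sum_(0 <= k < i) g k.+1) = (v%:Z + (g 0%N + \sum_(0 <= k < i) g k.+1) == 1)%:Z.
  by rewrite !addrA => ->; apply: IH.
case: eqP => [g0|_]; first by apply: E; rewrite g0 addr0.
case: eqP => [g0|_]; first by case/andP=> v0; apply: E; rewrite g0 (negPf v0).
by case: eqP => // g0 /= /andP[v1]; apply: E; rewrite g0 v1.
Qed.

(** Differences of edge values never violate the alternation, so only the last edge matters. *)
Lemma walk_diff (b : nat -> bool) n :
  walk (b 0%N) (mkseq (fun i => (b i.+1)%:Z - (b i)%:Z) n) = b n.
Proof.
elim: n b => [//|n IH] b; rewrite mkseq_cons /=.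
have := IH (b \o S) => /=.
by case E0: (b 0%N); case E1: (b 1%N) => /= ->.
Qed.

(** * Matrices encoded by their horizontal edges *)

Section States.
Variable n : nat.
Implicit Types (H : n.-tuple (n.-tuple bool)) (A : 'M[int]_n).

(* [H] lists the horizontal edges column by column; [hstate H j i] is the edge
   of row [i] just before column [j], hence the edge after column [j - 1]. *)
Definition hstate H (j i : nat) : bool :=
  nth false (nth [::] (nseq n false :: map val H) j) i.

Definition hdiff H (i j : nat) : int := (hstate H j.+1 i)%:Z - (hstate H j i)%:Z.

Definition state_mx H : 'M[int]_n := \matrix_(i, j) hdiff H i j.

Lemma hstate0 H i : hstate H 0 i = false.
Proof. by rewrite /hstate /= nth_nseq if_same. Qed.

Lemma hstateS H (j i : 'I_n) : hstate H j.+1 i = tnth (tnth H j) i.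
Proof. by rewrite /hstate /= (nth_map (tnth H j)) ?size_tuple // -!tnth_nth. Qed.

Lemma hdiff_entry H i j : hdiff H i j \in [:: 0; 1; -1].
Proof. by rewrite /hdiff; case: (hstate _ _ _); case: (hstate _ _ _). Qed.

Lemma sum_hdiff H i j : \sum_(0 <= k < j) hdiff H i k = (hstate H j i)%:Z.
Proof.
elim: j => [|j IH]; first by rewrite big_geq // hstate0.
by rewrite big_nat_recr //= IH /hdiff addrC subrK.
Qed.

Definition rowsum A (i : 'I_n) (j : nat) : int :=
  \sum_(0 <= k < j) nth 0 [seq A i k | k <- enum 'I_n] k.

Lemma map_enum_nth T (x0 : T) (f : 'I_n -> T) (k : 'I_n) :
  nth x0 [seq f k | k <- enum 'I_n] k = f k.
Proof. by rewrite (nth_map k) ?size_enum_ord // nth_ord_enum. Qed.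

Lemma rowsumS A i (j : 'I_n) : rowsum A i j.+1 = rowsum A i j + A i j.
Proof. by rewrite /rowsum big_nat_recr //= map_enum_nth. Qed.

Lemma map_enum_mkseq T (f : 'I_n -> T) (g : nat -> T) :
  (forall k : 'I_n, f k = g k) -> [seq f k | k <- enum 'I_n] = mkseq g n.
Proof. by move=> fg; rewrite /mkseq -val_enum_ord -map_comp; apply: eq_map. Qed.

Definition states A : n.-tuple (n.-tuple bool) :=
  [tuple [tuple rowsum A i j.+1 == 1 | i < n] | j < n].

Lemma is_asm_walk A : is_asm A =
  [&& [forall i, forall j, A i j \in [:: 0; 1; -1]],
      [forall i, walk false [seq A i j | j <- enum 'I_n]]
    & [forall j, walk false [seq A i j | i <- enum 'I_n]]].
Proof.
rewrite /is_asm; case: (boolP [forall i, _]) => // /forallP A01.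
have {}A01 i j : A i j \in [:: 0; 1; -1] by have /forallP := A01 i.
congr (_ && (_ && _)); apply: eq_forallb => i; rewrite alternates_walk //;
  by apply/allP => _ /mapP[j _ ->].
Qed.

Lemma rowsum_bool A i j : is_asm A -> (j <= n)%N ->
  rowsum A i j = (rowsum A i j == 1)%:Z.
Proof.
rewrite is_asm_walk => /and3P[_ /forallP/(_ i) w _] jn.
set s := [seq _ | _ <- _] in w *.
have sz : size s = n by rewrite size_map size_enum_ord.
rewrite -(mkseq_nth 0 s) sz in w.
by have := walk_partial w jn; rewrite !add0r.
Qed.

Lemma hstate_states A (i : 'I_n) j : is_asm A -> (j <= n)%N ->
  (hstate (states A) j i)%:Z = rowsum A i j.
Proof.
move=> Aasm; case: j => [|j] jn; first by rewrite hstate0 /rowsum big_geq.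
rewrite [RHS]rowsum_bool //; congr (Posz (nat_of_bool _)).
by have := hstateS (states A) (Ordinal jn) i; rewrite /= => ->; rewrite !tnth_mktuple.
Qed.

Definition entry_mx H : 'M[entry]_n := \matrix_(i, j) (SeqSub (hdiff_entry H i j) : entry).

Lemma int_entry_mx H : int_mx (entry_mx H) = state_mx H.
Proof. by apply/matrixP => i j; rewrite !mxE. Qed.

Lemma entry_mxK H : states (int_mx (entry_mx H)) = H.
Proof.
rewrite int_entry_mx; apply: eq_from_tnth => j; apply: eq_from_tnth => i.
rewrite !tnth_mktuple -hstateS; apply/eqP/idP => [|stT].
  rewrite /rowsum (map_enum_mkseq (g := hdiff H i)) => [|k]; last by rewrite mxE.
  under eq_big_nat => k /andP[_ kj] do rewrite nth_mkseq ?(leq_trans kj) //.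
  by rewrite sum_hdiff; case: hstate.
rewrite /rowsum (map_enum_mkseq (g := hdiff H i)) => [|k]; last by rewrite mxE.
under eq_big_nat => k /andP[_ kj] do rewrite nth_mkseq ?(leq_trans kj) //.
by rewrite sum_hdiff stT.
Qed.

Lemma statesK (B : 'M[entry]_n) : B \in ASM n -> entry_mx (states (int_mx B)) = B.
Proof.
rewrite inE => Basm; apply: int_mx_inj; rewrite int_entry_mx.
apply/matrixP => i j; rewrite mxE /hdiff !hstate_states // 1?ltnW //.
by rewrite rowsumS addrAC subrr add0r.
Qed.

Lemma sum_ASM_states (R : nmodType) (f : 'M[int]_n -> R) :
  \sum_(A in ASM n) f (int_mx A) =
  \sum_(H : n.-tuple (n.-tuple bool) | is_asm (state_mx H)) f (state_mx H).
Proof.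
rewrite (reindex_onto entry_mx (fun B => states (int_mx B))) => [|B BA]; last exact: statesK.
by apply: eq_big => H; rewrite ?inE ?entry_mxK ?eqxx ?andbT int_entry_mx.
Qed.

(** By [walk_diff] a row need only end in [true]; columns keep the full walk condition, as [H]
    records no vertical edges. *)
Lemma is_asm_state_mx H : is_asm (state_mx H) =
  [forall j : 'I_n, walk false (mkseq (fun i => hdiff H i j) n)] &&
  [forall i : 'I_n, hstate H n i].
Proof.
rewrite is_asm_walk (_ : [forall i, _] = true) /=; last first.
  by apply/forallP => i; apply/forallP => j; rewrite mxE hdiff_entry.
rewrite andbC; congr andb; apply: eq_forallb => i.
  by congr walk; apply: map_enum_mkseq => k; rewrite mxE.
rewrite (map_enum_mkseq (g := hdiff H i)) => [|k]; last by rewrite mxE.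
by rewrite -(walk_diff (fun j => hstate H j i)) hstate0.
Qed.

End States.

(** * Partition functions as sums of products of vertex weights *)

Section Bridge.
Variable R : idomainType.
Implicit Types (w : weight R) (ws : seq (weight R)) (cs : seq (seq (weight R))).

Lemma paths_sum m k cs h : size cs = k ->
  paths m cs h = \sum_(H : k.-tuple (m.-tuple bool))
    (\prod_(0 <= j < k) transfer (nth [::] cs j) false
       (nth [::] (h :: map val H) j) (nth [::] (map val H) j)) *
    (all id (nth [::] (h :: map val H) k))%:R.
Proof.
elim: k cs h => [|k IH] [|c cs] h //= => [_|[sz]].
  rewrite (bigD1 [tuple]) //= [X in _ + X]big1 ?addr0 => [|H].
    by rewrite big_geq ?mul1r.
  by rewrite tuple0.
rewrite (@big_tupleS _ _ k (fun H : seq (m.-tuple bool) =>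
  (\prod_(0 <= j < k.+1) transfer (nth [::] (c :: cs) j) false
       (nth [::] (h :: map val H) j) (nth [::] (map val H) j)) *
    (all id (nth [::] (map val H) k))%:R)) /=.
apply: eq_bigr => l _; rewrite IH // mulr_sumr; apply: eq_bigr => H _.
by rewrite big_nat_recl //= mulrA.
Qed.

(** The horizontal edges on both sides force the vertical ones, which are partial column sums: at
    each vertex at most one [v'] contributes. *)
Lemma transferE w0 ws v h h' : size h = size ws -> size h' = size ws ->
  let d i := (nth false h' i)%:Z - (nth false h i)%:Z in
  transfer ws v h h' = (walk v (mkseq d (size ws)))%:R *
    \prod_(0 <= i < size ws) nth w0 ws i (nth false h i) (nth false h' i)
      (v%:Z + \sum_(0 <= k < i) d k == 1).
Proof.
elim: ws v h h' => [|w ws IH] v [|a h] [|b h'] // => [_ _|[hs] [hs']] d.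
  by rewrite /= big_geq // mulr1.
rewrite [size _]/= mkseq_cons big_nat_recl //= big_geq // addr0 {}/d /=.
have v1 (u : bool) : (u%:Z == 1) = u by case: u.
have E (v' : bool) : v%:Z + (b%:Z - a%:Z) = v'%:Z ->
  transfer ws v' h h' =
  (walk v' (mkseq (fun i => (nth false h' i)%:Z - (nth false h i)%:Z) (size ws)))%:R *
  \prod_(0 <= i < size ws) nth w0 ws i (nth false h i) (nth false h' i)
  (v%:Z + \sum_(0 <= k < i.+1) ((nth false (b :: h') k)%:Z - (nth false (a :: h) k)%:Z) == 1).
  move=> vv; rewrite IH //; congr (_ * _); apply: eq_big_nat => i _.
  by rewrite big_nat_recl // addrA vv.
rewrite !big_bool v1.
move: E; case: a; case: b; case: v; rewrite /vertex /= => E;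
  rewrite ?(mul0r, add0r, addr0) ?[in RHS]mul0r //;
  by [rewrite (E true) // mulrCA | rewrite (E false) // mulrCA].
Qed.

Lemma prod_bool n (b : pred 'I_n) : \prod_j (b j)%:R = [forall j, b j]%:R :> R.
Proof.
case: (boolP [forall j, b j]) => [/forallP al|].
  by rewrite big1 // => j _; rewrite al.
by rewrite negb_forall => /existsP[j /negPf bj]; rewrite (bigD1 j) //= bj mul0r.
Qed.

Section Stats.
Variable n : nat.
Implicit Type H : n.-tuple (n.-tuple bool).

(** The vertical edge above row [i], hence below row [i - 1]. *)
Definition vstate H (i j : nat) : bool := \sum_(0 <= k < i) hdiff H k j == 1.

(** The column walks of [transferE] and the right boundary of [paths] together characterize ASMs;
    each generating function then only needs its statistics factored over vertices. *)
Lemma sum_ASM_paths w0 cs (f : 'M[int]_n -> R) : size cs = n ->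
  (forall j, (j < n)%N -> size (nth [::] cs j) = n) ->
  (forall H, is_asm (state_mx H) -> f (state_mx H) = \prod_(0 <= j < n) \prod_(0 <= i < n)
      nth w0 (nth [::] cs j) i (hstate H j i) (hstate H j.+1 i) (vstate H i j)) ->
  \sum_(A in ASM n) f (int_mx A) = paths n cs (nseq n false).
Proof.
move=> szc szi fE; rewrite sum_ASM_states (paths_sum _ _ szc) big_mkcond /=.
apply: eq_bigr => H _; rewrite is_asm_state_mx.
have hsz j : (j <= n)%N -> size (nth [::] (nseq n false :: map val H) j) = n.
  case: j => [|j] jn; first by rewrite size_nseq.
  by rewrite /= (nth_map (tnth H (Ordinal jn))) ?size_tuple.
transitivity ((\prod_(0 <= j < n) ((walk false (mkseq (fun i => hdiff H i j) n))%:R *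
  \prod_(0 <= i < n)  nth w0 (nth [::] cs j) i (hstate H j i) (hstate H j.+1 i) (vstate H i j)))
  * ([forall i : 'I_n, hstate H n i])%:R).
  rewrite big_split /= big_mkord.
  rewrite (prod_bool (fun j : 'I_n => walk _ (mkseq (fun i => hdiff H i j) n))).
  case wE: [forall j, walk _ _]; case sE: [forall i, hstate _ _ _];
    rewrite ?(mul0r, mulr0, mul1r, mulr1) //= fE // is_asm_state_mx wE sE//.
congr (_ * _).
  apply: eq_big_nat => j /andP[_ jn].
  have szj := hsz _ (ltnW jn); have szj1 : size (nth [::] (map val H) j) = n := hsz j.+1 jn.
  rewrite (@transferE w0) szi //; congr (_ * _); apply: eq_bigr => i _.
  by rewrite /vstate add0r.
congr (nat_of_bool _)%:R; apply/forallP/allP => [al b|al i].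
  case/(nthP false) => i; rewrite hsz // => iN <-; exact: (al (Ordinal iN)).
by apply: al; rewrite /hstate mem_nth // hsz.
Qed.
End Stats.
End Bridge.

(** * The statistics as sums over vertices *)

Lemma card_set_sum (T : finType) (P : pred T) : #|[set t | P t]| = (\sum_t P t)%N.
Proof. by rewrite -sum1dep_card big_mkcond; apply: eq_bigr => t _; case: (P t). Qed.

Lemma sum_count (b : nat -> bool) s : (\sum_(k <- s) b k)%N = count b s.
Proof. by rewrite -sum1_count [RHS]big_mkcond; apply: eq_bigr => k _; case: (b k). Qed.

Lemma exists_ord n (a : 'I_n) (P : 'I_n -> 'I_n -> bool) :
  [exists i : 'I_n, exists k : 'I_n, (i == a :> nat) && P i k] = [exists k, P a k].
Proof.
apply/existsP/existsP => [[i /existsP[k /andP[/eqP/val_inj-> Pk]]]|[k Pk]].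
  by exists k.
by exists a; apply/existsP; exists k; rewrite eqxx.
Qed.

Lemma Posz_sum_bool (b : nat -> bool) (d : nat -> int) i :
  (forall k, (k < i)%N -> d k = (b k)%:Z) ->
  (\sum_(0 <= k < i) b k)%N%:Z = \sum_(0 <= k < i) d k.
Proof.
move=> bd; rewrite (big_morph Posz PoszD (erefl _)).
by apply: eq_big_nat => k /andP[_ ki]; rewrite bd.
Qed.

Section OneTrue.
Variables (n : nat) (b : nat -> bool).
Hypothesis b1 : (\sum_(0 <= k < n) b k = 1)%N.

(** Turns the existential of [rhoT] and [rhoL] into a partial sum, that is, an edge value; the sum
    includes position [i]. *)
Lemma exists_one_after (i : 'I_n) :
  [exists k : 'I_n, [&& b k, (i < k)%N & ~~ b i]] = (\sum_(0 <= k < i.+1) b k == 0)%N.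
Proof.
have := b1; rewrite (@big_cat_nat _ _ _ i.+1) //= => sE.
apply/existsP/idP => [[k /and3P[bk ik _]]|/eqP s0].
  move: sE; rewrite (sum_count _ (index_iota i.+1 n)).
  suff : (0 < count b (index_iota i.+1 n))%N by lia.
  by rewrite -has_count; apply/hasP; exists (val k) => //; rewrite mem_index_iota ik /=.
have bi : b i = false by move: s0; rewrite big_nat_recr //=; case: (b i); lia.
have : has b (index_iota i.+1 n) by rewrite has_count -sum_count; lia.
case/hasP => k; rewrite mem_index_iota => /andP[ik kn] bk.
by exists (Ordinal kn); rewrite /= bk ik bi.
Qed.

(** The analogue for [rhoR]; the sum stops just before [i]. *)
Lemma exists_one_before (i : 'I_n) :
  [exists k : 'I_n, [&& b k, (k < i)%N & ~~ b i]] = (\sum_(0 <= k < i) b k == 1)%N.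
Proof.
have := b1; rewrite (@big_cat_nat _ _ _ i) //= 1?ltnW // => sE.
have iE : (b i <= \sum_(i <= k < n) b k)%N by rewrite big_ltn // leq_addr.
apply/existsP/idP => [[k /and3P[bk ki _]]|/eqP s0].
  move: sE; rewrite (sum_count _ (index_iota 0 i)).
  suff : (0 < count b (index_iota 0 i))%N by lia.
  by rewrite -has_count; apply/hasP; exists (val k) => //; rewrite mem_index_iota.
have bi : b i = false by move: iE; case: (b i) => //=; lia.
have : has b (index_iota 0 i) by rewrite has_count -sum_count; lia.
case/hasP => k; rewrite mem_index_iota => /andP[_ ki] bk.
by exists (Ordinal (ltn_trans ki (ltn_ord i))); rewrite /= bk ki bi.
Qed.
End OneTrue.

Section Stats.
Variables (n : nat) (H : n.-tuple (n.-tuple bool)).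
Hypothesis Hasm : is_asm (state_mx H).

Lemma sum_vstate i j : (j < n)%N -> (i <= n)%N ->
  \sum_(0 <= k < i) hdiff H k j = (vstate H i j)%:Z.
Proof.
move=> jn ile; move: Hasm; rewrite is_asm_state_mx => /andP[/forallP/(_ (Ordinal jn)) /= w _].
by have := walk_partial w ile; rewrite add0r.
Qed.

Lemma vstate0 j : vstate H 0 j = false.
Proof. by rewrite /vstate big_geq. Qed.

Lemma vstaten j : (j < n)%N -> vstate H n j.
Proof.
move=> jn; have /and3P[_ _ /forallP/(_ (Ordinal jn))/andP[_]] := Hasm.
rewrite big_map big_enum /= /vstate big_mkord => /eqP <-; apply/eqP.
by apply: eq_bigr => i _; rewrite mxE.
Qed.

Lemma hstaten i : (i < n)%N -> hstate H n i.
Proof.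
by move=> iN; move: Hasm; rewrite is_asm_state_mx => /andP[_ /forallP/(_ (Ordinal iN))].
Qed.

Lemma ice i j : (i < n)%N -> (j < n)%N ->
  (hstate H j i + vstate H i.+1 j = hstate H j.+1 i + vstate H i j)%N.
Proof.
move=> iN jn; have := sum_vstate jn iN.
by rewrite big_nat_recr //= (sum_vstate jn (ltnW iN)) /hdiff; lia.
Qed.

(** For a fixed vertex in row i' and column j, the sums over i < i' and j' <= j are the edges above
    it and on its right. *)
Lemma nu_state_mx :
  `|nu (state_mx H)|%N = (\sum_(j < n) \sum_(i < n) (hstate H j.+1 i && vstate H i j))%N.
Proof.
suff -> : nu (state_mx H) =
  (\sum_(j < n) \sum_(i < n) (hstate H j.+1 i && vstate H i j))%N%:Z by [].
rewrite /nu (exchange_big_dep predT) //= [in RHS]exchange_big /=.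
rewrite (big_morph Posz PoszD (erefl _)); apply: eq_bigr => i _.
rewrite exchange_big (big_morph Posz PoszD (erefl _)) /=; apply: eq_bigr => j _.
transitivity ((\sum_(0 <= k < i) hdiff H k j) * (\sum_(0 <= k < j.+1) hdiff H i k)).
  rewrite !big_mkord (big_ord_widen n (hdiff H ^~ j)) 1?ltnW // (big_ord_widen n (hdiff H i)) //.
  rewrite mulr_suml; apply: eq_bigr => k _; rewrite mulr_sumr.
  by apply: eq_bigr => l _; rewrite !mxE.
rewrite sum_vstate // 1?ltnW // sum_hdiff.
by case: (vstate _ _ _); case: (hstate _ _ _).
Qed.

Lemma mu_state_mx :
  mu (state_mx H) = (\sum_(j < n) \sum_(i < n) (hstate H j i && ~~ hstate H j.+1 i))%N.
Proof.
rewrite /mu card_set_sum exchange_big pair_big; apply: eq_bigr => -[i j] _ /=.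
by rewrite mxE /hdiff; case: (hstate _ _ _); case: (hstate _ _ _).
Qed.

End Stats.

Section Boundary.
Variables (m : nat) (H : m.+1.-tuple (m.+1.-tuple bool)).
Hypothesis Hasm : is_asm (state_mx H).

(** A top entry is a 0 left of the 1 exactly when the edge on its right is still [false]. The double
    sum with an indicator prepares a product over all vertices. *)
Lemma rhoT_state_mx : rhoT (state_mx H) =
  (\sum_(j < m.+1) \sum_(i < m.+1) ((i == 0 :> nat) && ~~ hstate H j.+1 i))%N.
Proof.
rewrite /rhoT card_set_sum; apply: eq_bigr => j _.
rewrite (exists_ord ord0 (fun i k => [&& state_mx H i k == 1, (j < k)%N & state_mx H i j == 0])).
rewrite big_ord_recl /= [X in (_ + X)%N]big1 // addn0.
have bd k : (k < m.+1)%N -> hdiff H 0 k = (vstate H 1 k)%:Z.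
  by move=> km; rewrite -(sum_vstate Hasm km) // big_nat1.
have b1 : (\sum_(0 <= k < m.+1) vstate H 1 k = 1)%N.
  by apply: (can_inj absz_nat); rewrite (Posz_sum_bool bd) sum_hdiff hstaten.
have -> : ~~ hstate H j.+1 0 = (\sum_(0 <= k < j.+1) vstate H 1 k == 0)%N.
  have := @Posz_sum_bool (vstate H 1) (hdiff H 0) j.+1.
  rewrite sum_hdiff => E.
  have /E : forall k, (k < j.+1)%N -> hdiff H 0 k = (vstate H 1 k)%:Z.
    by move=> k kj; apply: bd; apply: leq_trans kj _.
  by case: (hstate _ _ _); lia.
rewrite -(exists_one_after b1); congr nat_of_bool; apply: eq_existsb => k.
by rewrite !mxE !bd //; case: (vstate _ _ _); case: (vstate _ _ _).
Qed.

Lemma rhoL_state_mx : rhoL (state_mx H) =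
  (\sum_(j < m.+1) \sum_(i < m.+1) ((j == 0 :> nat) && ~~ vstate H i.+1 j))%N.
Proof.
rewrite /rhoL card_set_sum exchange_big; apply: eq_bigr => i _.
rewrite (exists_ord ord0 (fun j k => [&& state_mx H k j == 1, (i < k)%N & state_mx H i j == 0])).
rewrite big_ord_recl /= [X in (_ + X)%N]big1 // addn0.
have bd k : hdiff H k 0 = (hstate H 1 k)%:Z by rewrite /hdiff hstate0 subr0.
have sE l : (l <= m.+1)%N -> (\sum_(0 <= k < l) hstate H 1 k)%N = vstate H l 0.
  move=> lm; apply: (can_inj absz_nat); rewrite (Posz_sum_bool (fun k _ => bd k)).
  by rewrite (sum_vstate Hasm).
rewrite -[~~ vstate _ _ _]eqb0 -sE // -exists_one_after ?sE ?(vstaten Hasm) //.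
congr nat_of_bool; apply: eq_existsb => k.
by rewrite !mxE !bd //; case: (hstate _ _ _); case: (hstate _ _ _).
Qed.

Lemma rhoR_state_mx : rhoR (state_mx H) =
  (\sum_(j < m.+1) \sum_(i < m.+1) ((j == m :> nat) && vstate H i j))%N.
Proof.
rewrite /rhoR card_set_sum exchange_big; apply: eq_bigr => i _.
under eq_existsb => j do under eq_existsb => k do rewrite eqSS.
rewrite (exists_ord ord_max (fun j k => [&& state_mx H k j == 1, (k < i)%N & state_mx H i j == 0])).
rewrite big_ord_recr /= big1 ?add0n ?eqxx => [|j _]; last by rewrite ltn_eqF.
(* The right boundary is [true], so a last-column entry is 1 if its left edge is [false] and 0
   otherwise. *)
have bd k : (k < m.+1)%N -> hdiff H k m = (~~ hstate H m k)%:Z.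
  by move=> km; rewrite /hdiff hstaten //; case: hstate.
have sE l : (l <= m.+1)%N -> (\sum_(0 <= k < l) ~~ hstate H m k)%N = vstate H l m.
  move=> lm; apply: (can_inj absz_nat); rewrite (@Posz_sum_bool _ (hdiff H ^~ m)).
    by rewrite (sum_vstate Hasm).
  by move=> k kl; apply: bd; apply: leq_trans kl _.
rewrite -[vstate _ _ _ in RHS]eqb1 -sE 1?ltnW //.
rewrite -(exists_one_before (b := fun k => ~~ hstate H m k)) ?sE ?(vstaten Hasm) //.
congr nat_of_bool; apply: eq_existsb => k.
by rewrite !mxE !bd //; case: (hstate _ _ _); case: (hstate _ _ _).
Qed.

End Boundary.

(** * Generating functions as partition functions *)

Section GeneratingFunctions.
Variables (R : idomainType) (x y z1 z2 : R).

Lemma prod_expr n (z : R) (e : nat -> nat -> nat) :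
  z ^+ (\sum_(j < n) \sum_(i < n) e j i)%N = \prod_(0 <= j < n) \prod_(0 <= i < n) z ^+ e j i.
Proof.
by rewrite expr_sum big_mkord; apply: eq_bigr => j _; rewrite expr_sum big_mkord.
Qed.

Lemma prod_bulk n (H : n.-tuple (n.-tuple bool)) : is_asm (state_mx H) ->
  x ^+ `|nu (state_mx H)|%N * y ^+ mu (state_mx H) =
  \prod_(0 <= j < n) \prod_(0 <= i < n) bulk x y (hstate H j i) (hstate H j.+1 i) (vstate H i j).
Proof.
move=> Hasm; rewrite nu_state_mx // mu_state_mx.
rewrite (prod_expr _ _ (fun j i => hstate H j.+1 i && vstate H i j)).
rewrite (prod_expr _ _ (fun j i => hstate H j i && ~~ hstate H j.+1 i)).
by rewrite -big_split; apply: eq_bigr => j _; rewrite -big_split.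
Qed.

Lemma Z_paths n : Z n x y = paths n (nseq n (nseq n (bulk x y))) (nseq n false).
Proof.
rewrite -(@sum_ASM_paths R n (bulk x y) _ (fun A => x ^+ `|nu A|%N * y ^+ mu A)) //.
- by rewrite size_nseq.
- by move=> j jn; rewrite nth_nseq jn size_nseq.
move=> H Hasm; rewrite prod_bulk //; apply: eq_big_nat => j /andP[_ jn].
by apply: eq_big_nat => i /andP[_ iN]; rewrite !nth_nseq jn nth_nseq iN.
Qed.

(** A 0 in the top left corner is counted by both [rhoT] and [rhoL], hence the corner weight
    [z1 * z2]. *)
Lemma Zadj_paths m : Zadj m.+1 x y z1 z2 =
  paths m.+1 ((corner (z1 * z2) 1 1 :: nseq m (special x y z2)) ::
              nseq m (top x y z1 :: nseq m (bulk x y))) (nseq m.+1 false).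
Proof.
rewrite -(@sum_ASM_paths R m.+1 (bulk x y) _ (fun A =>
  x ^+ `|nu A|%N * y ^+ mu A * z1 ^+ rhoT A * z2 ^+ rhoL A)) //.
- by rewrite /= size_nseq.
- by move=> [|j] jn /=; rewrite ?nth_nseq 1?[(j < m)%N]jn /= size_nseq.
move=> H Hasm; rewrite prod_bulk // rhoT_state_mx // rhoL_state_mx //.
rewrite (prod_expr _ _ (fun j i => (i == 0 :> nat) && ~~ hstate H j.+1 i)).
rewrite (prod_expr _ _ (fun j i => (j == 0 :> nat) && ~~ vstate H i.+1 j)).
rewrite -!big_split; apply: eq_big_nat => j /andP[_ jn].
rewrite -!big_split; apply: eq_big_nat => i /andP[_ iN] /=.
(* The ice rule discards the edge values at which the local weights would differ. *)
have := ice Hasm iN jn.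
case: j jn => [|j] jn; rewrite ?hstate0; case: i iN => [|i] iN; rewrite ?vstate0 /=.
- by rewrite /bulk /corner; case: (hstate _ _ _); case: (vstate _ _ _) => //= _; ring.
- rewrite nth_nseq [(i < m)%N]iN /bulk /special.
  by case: (hstate _ _ _); case: (vstate _ _ _); case: (vstate _ _ _) => //= _; ring.
- by rewrite nth_nseq [(j < m)%N]jn /= /top => _; rewrite mulr1 mulrC.
- by rewrite nth_nseq [(j < m)%N]jn /= nth_nseq [(i < m)%N]iN !mulr1.
Qed.

(** A 0 in the top right corner lies right of the top 1 and above the last column's 1, so neither
    [rhoT] nor [rhoR] counts it. *)
Lemma Zadjt_paths m : Zadjt m.+1 x y z1 z2 =
  paths m.+1 (rcons (nseq m (top x y z1 :: nseq m (bulk x y)))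
     (corner 1 1 1 :: nseq m (special x y z2))) (nseq m.+1 false).
Proof.
rewrite -(@sum_ASM_paths R m.+1 (bulk x y) _ (fun A =>
  x ^+ `|nu A|%N * y ^+ mu A * z1 ^+ rhoT A * z2 ^+ rhoR A)) //.
- by rewrite size_rcons size_nseq.
- move=> j jn; rewrite nth_rcons size_nseq nth_nseq.
  case: ltnP => jm /=; first by rewrite size_nseq.
  by rewrite (_ : j == m) ?eqn_leq ?jm ?andbT //= size_nseq.
move=> H Hasm; rewrite prod_bulk // rhoT_state_mx // rhoR_state_mx //.
rewrite (prod_expr _ _ (fun j i => (i == 0 :> nat) && ~~ hstate H j.+1 i)).
rewrite (prod_expr _ _ (fun j i => (j == m :> nat) && vstate H i j)).
rewrite -!big_split; apply: eq_big_nat => j /andP[_ jn].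
rewrite -!big_split; apply: eq_big_nat => i /andP[_ iN] /=.
have := ice Hasm iN jn.
rewrite nth_rcons size_nseq nth_nseq.
case: (ltngtP j m) jn => [jm jn|mj|-> _]; last 1 first.
- rewrite hstaten //; case: i iN => [|i] iN; rewrite ?vstate0 /=.
    by rewrite /bulk /corner; case: (hstate _ _ _); case: (vstate _ _ _) => //= _; ring.
  rewrite nth_nseq [(i < m)%N]iN /bulk /special.
  by case: (hstate _ _ _); case: (vstate _ _ _); case: (vstate _ _ _) => //= _; ring.
- case: i iN => [|i] iN; rewrite ?vstate0 /=; first by rewrite /top mulr1 mulrC.
  by rewrite nth_nseq [(i < m)%N]iN !mulr1.
by rewrite ltnS leqNgt mj.
Qed.

End GeneratingFunctions.

Theorem corollary7 (n : nat) (hn : (2 <= n)%N) :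
  let x  : {mpoly int[4]} := 'X_0 in
  let y  : {mpoly int[4]} := 'X_1 in
  let z1 : {mpoly int[4]} := 'X_2 in
  let z2 : {mpoly int[4]} := 'X_3 in
  ((z1 - 1) * (z2 - 1) - y * z1 * z2) * Zadj n x y z1 z2
    - (x * (z1 - 1) * (z2 - 1) - y) * z1 * z2 * Zadjt n x y z1 z2
  = (z1 - 1) * (z2 - 1) * (1 - (x * z1 * z2) ^+ n) * Z n.-1 x y.
Proof.
case: n hn => [//|m] _ x y z1 z2.
rewrite Zadj_paths Zadjt_paths Z_paths; apply: paths_relation.
(* At y = 1 with the other variables 0, the factor to be cancelled evaluates to 1. *)
apply/eqP => /(congr1 (meval (fun i : 'I_4 => (i == 1)%:R))).
by rewrite mevalD mevalM mevalB !mevalXU meval1 meval0.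
Qed.
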